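(* Let $X,Y$ be Banach spaces, $F:X\rightrightarrows Y$ a closed multifunction, $A\subset X$ a closed set, $b\in Y$, $S:=\{x\in A:\ b\in F(x)\}$, and $a\in S$. Suppose that $F$ is $\mathcal{L}$-subsmooth at $(a,b)$, that $A$ is subsmooth at $a$, and that there exist $\tau,\delta\in(0,+\infty)$ such that $$N_c(S,z)\cap B_{X^*}\subset\tau\big(D_c^*F(z,b)(B_{Y^*})+N_c(A,z)\cap B_{X^*}\big)\qquad\forall z\in S\cap B(a,\delta).$$ Then the generalized equation ''$b\in F(x)$ subject to $x\in A$'' is metrically subregular at $a$.
   Context: $B_{X^*},B_{Y^*}$ are the closed unit balls of the dual spaces; $B(a,\delta)$ is the open ball with center $a$ and radius $\delta$; $d(\cdot,C)$ is the distance to a set $C$ (with $d(\cdot,\emptyset)=+\infty$). A multifunction $F$ is closed if its graph $\mathrm{gph}(F)=\{(x,y): y\in F(x)\}$ is closed; $F^{-1}$ is defined by $x\in F^{-1}(y)\iff y\in F(x)$. The generalized equation is metrically subregular at $a\in S$ if there exists $\tau\in(0,+\infty)$ such that $d(x,S)\le\tau(d(b,F(x))+d(x,A))$ for all $x$ close to $a$. For a closed set $C$ in a Banach space and $a\in C$: the Clarke tangent cone $T_c(C,a)$ is the set of $v$ such that for all sequences $a_n\to a$ with $a_n\in C$ and $t_n\to0^+$ there exist $v_n\to v$ with $a_n+t_nv_n\in C$ for all $n$; the Clarke normal cone is $N_c(C,a)=\{x^*:\langle x^*,h\rangle\le0\ \forall h\in T_c(C,a)\}$. For $(x,y)\in\mathrm{gph}(F)$,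 the Clarke coderivative is $D_c^*F(x,y)(y^* )=\{x^*\in X^*:(x^*,-y^* )\in N_c(\mathrm{gph}(F),(x,y))\}$, and $D_c^*F(x,y)(V)=\bigcup_{y^*\in V}D_c^*F(x,y)(y^* )$. Sums of sets are Minkowski sums. A closed set $A$ is subsmooth at $a\in A$ if for any $\varepsilon>0$ there exists $\delta>0$ such that $\langle x^*-u^*,x-u\rangle\ge-\varepsilon\|x-u\|$ whenever $x,u\in B(a,\delta)\cap A$, $x^*\in N_c(A,x)\cap B_{X^*}$ and $u^*\in N_c(A,u)\cap B_{X^*}$. A closed multifunction $G:U\rightrightarrows V$ between Banach spaces is L-subsmooth at $(p,q)\in\mathrm{gph}(G)$ if for any $\varepsilon>0$ there exists $\delta>0$ such that $\langle u^*,x-p\rangle+\langle v^*,y-v\rangle\le\varepsilon(\|x-p\|+\|y-v\|)$ whenever $v\in G(p)\cap B(q,\delta)$, $(u^*,v^* )\in N_c(\mathrm{gph}(G),(p,v))\cap(B_{U^*}\times B_{V^*})$, and $(x,y)\in\mathrm{gph}(G)$ with $\|x-p\|+\|y-q\|<\delta$. $F$ is $\mathcal{L}$-subsmooth at $(a,b)\in\mathrm{gph}(F)$ if $F^{-1}$ is L-subsmooth at $(b,a)$. *)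

(* Defs.v *)
From HB Require Import structures.
From mathcomp Require Import all_boot all_order all_algebra.
From mathcomp Require Import all_classical all_reals all_analysis.

Set Implicit Arguments.
Unset Strict Implicit.
Unset Printing Implicit Defensive.

Import Order.TTheory GRing.Theory Num.Theory.
Import numFieldNormedType.Exports.

Local Open Scope classical_set_scope.
Local Open Scope ring_scope.

Section Dual.
Context {R : realType} (V : normedModType R).

(* Elements of the topological dual are represented by their underlying
   functions, so that sums and scalings of sets of functionals use the
   pointwise module structure on [V -> R^o]. *)
Definition dual : set (V -> R^o) := [set f | linear f /\ continuous f].

(* The real-valued [sup] is the true supremum for every [f] in [dual]. *)
Definition dual_norm (f : V -> R^o) : R :=
  sup [set `|f x| | x in [set x : V | `|x| <= 1]].

Definition dual_ball : set (V -> R^o) := [set f | dual f /\ dual_norm f <= 1].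

End Dual.
Arguments dual {R} V _.
Arguments dual_ball {R} V _.

Section Minkowski.
Context {R : realType} {E : lmodType R}.

Definition mink_add (P Q : set E) : set E := [set x + y | x in P & y in Q].

Definition mink_scale (t : R) (P : set E) : set E := [set t *: x | x in P].

End Minkowski.

Section ClarkeCones.
Context {R : realType} {V : normedModType R}.

Definition clarke_tangent (C : set V) (a : V) : set V :=
  [set v | forall (a_ : nat -> V) (t_ : nat -> R),
     (forall n, C (a_ n)) -> a_ @ \oo --> a ->
     (forall n, 0 < t_ n) -> t_ @ \oo --> (0 : R) ->
     exists2 v_ : nat -> V, v_ @ \oo --> v &
       forall n, C (a_ n + t_ n *: v_ n)].

Definition clarke_normal (C : set V) (a : V) : set (V -> R^o) :=
  [set f | dual V f /\ forall h, clarke_tangent C a h -> f h <= 0].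

Definition subsmooth (A : set V) (a : V) : Prop :=
  forall eps : R, 0 < eps -> exists2 delta : R, 0 < delta &
    forall (x u : V) (xs us : V -> R^o),
      (ball a delta `&` A) x -> (ball a delta `&` A) u ->
      (clarke_normal A x `&` dual_ball V) xs ->
      (clarke_normal A u `&` dual_ball V) us ->
      - eps * `|x - u| <= (xs - us) (x - u).

End ClarkeCones.

Section Multifunctions.
Context {R : realType} {U V : normedModType R}.

Definition gph (G : U -> set V) : set (U * V) := [set p | G p.1 p.2].

Definition inv_mf (G : U -> set V) : V -> set U := fun y => [set x | G x y].

(* The functional on [U * V] identified with the pair [(f, g)]. *)
Definition dual_pair (f : U -> R^o) (g : V -> R^o) : (U * V)%type -> R^o :=
  fun p => f p.1 + g p.2.

Definition clarke_coderivative (G : U -> set V) (x : U) (y : V)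
    (ys : V -> R^o) : set (U -> R^o) :=
  [set xs | dual U xs /\ clarke_normal (gph G) (x, y) (dual_pair xs (- ys))].

Definition clarke_coderivative_set (G : U -> set V) (x : U) (y : V)
    (W : set (V -> R^o)) : set (U -> R^o) :=
  \bigcup_(ys in W) clarke_coderivative G x y ys.

Definition L_subsmooth (G : U -> set V) (p : U) (q : V) : Prop :=
  forall eps : R, 0 < eps -> exists2 delta : R, 0 < delta &
    forall (v : V) (us : U -> R^o) (vs : V -> R^o) (x : U) (y : V),
      (G p `&` ball q delta) v ->
      clarke_normal (gph G) (p, v) (dual_pair us vs) ->
      dual_ball U us -> dual_ball V vs ->
      gph G (x, y) -> `|x - p| + `|y - q| < delta ->
      us (x - p) + vs (y - v) <= eps * (`|x - p| + `|y - v|).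

Definition solution_set (F : U -> set V) (A : set U) (b : V) : set U :=
  [set x | A x /\ F x b].

Definition metrically_subregular (F : U -> set V) (A : set U) (b : V)
    (a : U) : Prop :=
  exists2 tau : R, 0 < tau & \forall x \near a,
    (edist_inf (solution_set F A b) x <=
       tau%:E * (edist_inf (F x) b + edist_inf A x))%E.

End Multifunctions.

Definition calL_subsmooth {R : realType} {X Y : normedModType R}
    (F : X -> set Y) (a : X) (b : Y) : Prop :=
  L_subsmooth (inv_mf F) b a.

(* Main.v *)
From HB Require Import structures.
Require Import Defs.
From mathcomp Require Import all_boot all_order all_algebra.
From mathcomp Require Import unstable all_classical all_reals all_analysis.
From mathcomp Require Import ring lra.

Import Order.TTheory GRing.Theory Num.Theory.
Import numFieldNormedType.Exports.

Local Open Scope classical_set_scope.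
Local Open Scope ring_scope.

(** Fix [x] near [a], and let [S] be the solution set. The point is to find
    [z] in [S], no farther from [x] than [a] is, together with a functional
    [psi] of norm at most one in the Clarke normal cone of [S] at [z] such that
    [|x - z| <= 2 psi (x - z)] (lemma [exists_normal_towards]). The hypothesis on
    normal cones then splits [psi] as [tau (x1 + x2)], with [x1] in a
    coderivative of [F] at [(z, b)] and [x2] normal to [A] at [z].
    Subsmoothness of [A] compares [x2 (x - z)] with [|x - u|] for every [u] in
    [A], and subsmoothness of the inverse of [F] compares [x1 (x - z)] with
    [|b - y|] for every [y] in [F x]; both comparisons lose only a small
    multiple of [|x - z|] (lemmas [subsmooth_normal_le] and
    [L_subsmooth_coderivative_le]). For a small enough [eps] this loss is
    absorbed by the left-hand side, which leaves
    [|x - z| <= K (|b - y| + |x - u|)], and infima over [y] and [u] give metric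
    subregularity.

    What matters about [z] is its closeness to [a], which puts it in the
    neighbourhoods where the hypotheses speak; it does not have to be a nearly
    nearest point. So [z] is taken from Ekeland's variational principle applied
    to the distance to [x], started at [a]. It minimizes over [S] a
    convex Lipschitz function, the distance to [x] plus a third of the distance
    to [z], and the Fermat rule [fermat_clarke_normal] produces [psi]. That rule
    is a separation argument. It is derived from a form of the Hahn-Banach
    theorem stated for convex cones ([linear_minorant]), which suits it because
    the Clarke tangent cone is always convex. *)

(** * Linear functionals dominated on a convex cone *)

Section ConeExtension.
Set Implicit Arguments.
Unset Strict Implicit.
Context {R : realType} {E : lmodType R}.
Implicit Types M C : set (E * R).

(** A pair [(h, r)] of the cone stands for the constraint [phi h <= r] on a
    linear functional [phi]. Adding and scaling constraints gives constraints, and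
    those on [phi 0 = 0] have to be satisfiable. *)
Definition minorizing_cone M :=
  [/\ M (0, 0),
      forall h r h' r', M (h, r) -> M (h', r') -> M (h + h', r + r'),
      forall t h r, 0 < t -> M (h, r) -> M (t *: h, t * r) &
      forall r, M (0, r) -> 0 <= r].

(** The union of a chain of such cones is again one, so Zorn's lemma applies. *)
Lemma maximal_minorizing_cone C : minorizing_cone C ->
  exists M, [/\ minorizing_cone M, C `<=` M &
    forall M', minorizing_cone M' -> M `<=` M' -> M' `<=` M].
Proof.
move=> coneC.
(* the empty set is admitted because it is the union of the empty chain *)
pose P M := M = set0 \/ (C `<=` M /\ minorizing_cone M).
have [F FP totF|M [PM maxM]] := @Zorn_bigcup _ P.
  have [[D0 [FD0 [x0 D0x0]]]|F0] := pselect (exists D, F D /\ D !=set0);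
    last first.
    left; rewrite -subset0 => x [D FD Dx]; apply: F0.
    by exists D; split=> //; exists x.
  have good D x : F D -> D x -> C `<=` D /\ minorizing_cone D.
    by move=> FD Dx; case: (FP _ FD) => // D_0; move: Dx; rewrite D_0.
  have [CD0 _] := good _ _ FD0 D0x0.
  have CF : C `<=` \bigcup_(X in F) X by move=> y /CD0 ?; exists D0.
  right; split=> //; split.
  - by apply: CF; case: coneC.
  - move=> h r h' r' [D FD Dh] [D' FD' Dh'].
    have [DD'|D'D] := totF _ _ FD FD'.
      have [_ [_ add _ _]] := good _ _ FD' Dh'.
      by exists D' => //; apply: add => //; exact: DD'.
    have [_ [_ add _ _]] := good _ _ FD Dh.
    by exists D => //; apply: add => //; exact: D'D.
  - move=> t h r t0 [D FD Dh]; exists D => //.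
    by have [_ [_ _ scale _]] := good _ _ FD Dh; exact: scale.
  - move=> r [D FD D0r]; have [_ [_ _ _ pos]] := good _ _ FD D0r; exact: pos.
case: PM => [M0|[CM coneM]].
  exfalso; apply: (maxM C); last by right; split=> [x|].
  rewrite M0; split; first exact: sub0set.
  by case: coneC => C0 _ _ _ sub; exact: (sub _ C0).
exists M; split=> // M' coneM' MM'; apply: contrapT => nM'M.
by apply: (maxM M'); [split | right; split=> //; exact: subset_trans MM'].
Qed.

(** A Hahn-Banach theorem: constraints that are consistent above [0] have a
    common linear solution as soon as every vector is constrained. In a maximal
    cone [M] the least bound [p h] is the solution: [M] can absorb the constraint
    [p h <= phi h] without losing consistency, so [p] is odd, and an odd
    sublinear function is linear. *)
Lemma linear_minorant C : minorizing_cone C -> (forall h, exists r, C (h, r)) ->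
  exists2 phi : E -> R^o, linear phi & forall h r, C (h, r) -> phi h <= r.
Proof.
move=> coneC lineC.
have [M [[M0 add scale pos] CM maxM]] := maximal_minorizing_cone coneC.
pose line h := [set r | M (h, r)].
pose p h : R := inf (line h).
have lineN0 h : line h !=set0 by have [r /CM] := lineC h; exists r.
have lineB h : has_lbound (line h).
  have [s Ms] := lineN0 (- h); exists (- s) => r Mr.
  by rewrite -subr_ge0 opprK; apply: pos; rewrite -(subrr h); exact: add.
have p_le h r : M (h, r) -> p h <= r by move=> Mr; exact: ge_inf.
have p_scale t h r : 0 < t -> M (t *: h, r) -> t * p h <= r.
  move=> t0 Mr; rewrite -ler_pdivlMl//; apply: p_le.
  rewrite -[h]scale1r -(mulVf (lt0r_neq0 t0)) -scalerA.
  by apply: scale; rewrite ?invr_gt0.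
(* adding the ray spanned by (- h, - p h) keeps the cone consistent *)
have opp_graph h : M (- h, - p h).
  pose M1 : set (E * R) := [set x | exists t m,
     [/\ 0 <= t, M m & x = (m.1 - t *: h, m.2 - t * p h)]].
  suff coneM1 : minorizing_cone M1.
    apply: (maxM _ coneM1).
      by move=> [k r] Mk; exists 0, (k, r); rewrite /= scale0r mul0r !subr0.
    by exists 1, (0, 0); rewrite /= scale1r mul1r !sub0r.
  split.
  - by exists 0, (0, 0); rewrite /= scale0r mul0r !subr0.
  - move=> _ _ _ _ [t [[k r] [t0 Mk [-> ->]]]] [t' [[k' r'] [t'0 Mk' [-> ->]]]].
    exists (t + t'), (k + k', r + r'); split; [exact: addr_ge0 | exact: add |].
    by rewrite /= scalerDl mulrDl !opprD; congr pair; rewrite addrACA.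
  - move=> s _ _ s0 [t [[k r] [t0 Mk [-> ->]]]].
    exists (s * t), (s *: k, s * r).
    split; [exact/mulr_ge0/t0/ltW | exact: scale |].
    by rewrite /= scalerBr scalerA mulrBr mulrA.
  - move=> _ [t [[k r] [t0 Mk /= [/esym/eqP]]]] + ->.
    rewrite subr_eq0 subr_ge0 => /eqP kth.
    move: t0 kth; rewrite le_eqVlt => /predU1P[<-|t0] kth; rewrite kth in Mk.
      by rewrite mul0r; apply: pos; rewrite -(scale0r h).
    exact: p_scale.
have pN h : p (- h) = - p h.
  apply/le_anti/andP; split; first exact: p_le.
  apply: lb_le_inf => // r Mr; rewrite lerNl; apply: lb_le_inf => // s Ms.
  by rewrite -subr_ge0 opprK; apply: pos; rewrite -(subrr h); exact: add.
have graph h : M (h, p h) by have := opp_graph (- h); rewrite pN !opprK.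
have pD h k : p (h + k) = p h + p k.
  apply/le_anti/andP; split; first exact/p_le/add.
  by rewrite -lerN2 -pN !opprD -!pN; exact/p_le/add.
have p_pos t h : 0 < t -> p (t *: h) = t * p h.
  move=> t0; apply/le_anti/andP; split; first exact/p_le/scale.
  exact: p_scale.
exists p => [t h k|h r /CM]; last exact: p_le.
rewrite pD; congr (_ + _).
have [t0|t0|->] := ltgtP t 0; last 2 first.
- exact: p_pos.
- rewrite !scale0r; apply/le_anti; rewrite p_le//=; exact: pos.
- by rewrite -[LHS]opprK -pN -scaleNr p_pos ?oppr_gt0// mulNr opprK.
Qed.
End ConeExtension.

(** * Bounded functionals *)

Section DualFacts.
Set Implicit Arguments.
Unset Strict Implicit.
Context {R : realType} {V : normedModType R}.
Implicit Types (f : V -> R^o) (L : R).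

Lemma linear_rules f : linear f ->
  [/\ forall x y, f (x + y) = f x + f y, forall t x, f (t *: x) = t * f x &
      forall x, f (- x) = - f x].
Proof.
move=> linf.
pose g : {linear V -> R^o} := HB.pack f (GRing.isLinear.Build _ _ _ _ f linf).
split=> [x y|t x|x]; [exact: (linearD g) | | exact: (linearN g)].
exact: (linearZ_LR g t x).
Qed.

Lemma bounded_dual f L : linear f -> (forall x, `|f x| <= L * `|x|) -> dual V f.
Proof.
move=> linf fL; split=> //.
pose g : {linear V -> R^o} := HB.pack f (GRing.isLinear.Build _ _ _ _ f linf).
apply: (@bounded_linear_continuous _ _ _ g); apply/linear_boundedP.
near=> r => x; apply: (le_trans (fL x)); rewrite ler_wpM2r//.
Unshelve. all: by end_near. Qed.

(** Replaces the supremum that defines the dual norm by the pointwise bound. *)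
Lemma dual_ballP f : dual_ball V f <-> linear f /\ forall x, `|f x| <= `|x|.
Proof.
split=> [[[linf cf] nf]|[linf f1]].
  split=> // x; have [_ fZ _] := linear_rules linf.
  pose g : {linear V -> R^o} := HB.pack f (GRing.isLinear.Build _ _ _ _ f linf).
  have /linear_boundedP/pinfty_ex_gt0[r r0 fr] : bounded_near g (nbhs (0 : V)).
    exact/linear_bounded_continuous.
  (* r bounds the set whose supremum is the dual norm, so that sup is genuine *)
  have [->|x0] := eqVneq x 0; first by rewrite -(scale0r 0) fZ mul0r !normr0.
  have nx0 : 0 < `|x| by rewrite normr_gt0.
  have : `|f (`|x|^-1 *: x)| <= 1.
    apply: le_trans nf; apply: ub_le_sup.
      exists r => _ [y /= y1 <-]; apply: (le_trans (fr y)).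
      by rewrite ler_piMr// ltW.
    exists (`|x|^-1 *: x) => //=.
    by rewrite normrZ normfV normr_id mulVf// gt_eqF.
  by rewrite fZ normrM normfV normr_id ler_pdivrMl// mulr1.
split; first by apply: (@bounded_dual _ 1) => // x; rewrite mul1r.
apply: ge_sup; first by exists `|f 0|, 0 => //=; rewrite normr0.
by move=> _ [x /= x1 <-]; exact: le_trans (f1 x) x1.
Qed.

Lemma dual_scale f t : dual V f -> dual V (t *: f).
Proof.
move=> [linf cf]; split=> [s x y|x].
  rewrite !fctE linf [RHS]addrC scalerDr [LHS]addrC; congr (_ + _).
  by rewrite !scalerA mulrC.
by apply: continuousZr; exact: cf.
Qed.

End DualFacts.

(** * Clarke tangent and normal cones *)

Section TangentCone.
Set Implicit Arguments.
Unset Strict Implicit.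
Context {R : realType} {V : normedModType R}.
Implicit Types (C : set V) (a h k : V).

Lemma clarke_tangent0 C a : clarke_tangent C a 0.
Proof.
move=> a_ t_ Ca _ _ _; exists (fun=> 0); first exact: cvg_cst.
by move=> n; rewrite scaler0 addr0.
Qed.

Lemma clarke_tangentZ C a h t : 0 < t ->
  clarke_tangent C a h -> clarke_tangent C a (t *: h).
Proof.
move=> t0 Th a_ t_ Ca aa pos_t t_0.
have [//|//|||v_ vh Cv] := Th a_ (fun n => t_ n * t).
- by move=> n; rewrite mulr_gt0.
- by rewrite -(mul0r t); apply: cvgMr_tmp.
exists (fun n => t *: v_ n); first exact: cvgZl_tmp.
by move=> n; rewrite scalerA.
Qed.

(** Convexity of the Clarke cone comes from the freedom of the base points: the
    points reached along [h] serve as base points for the motion along [k]. *)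
Lemma clarke_tangentD C a h k : clarke_tangent C a h -> clarke_tangent C a k ->
  clarke_tangent C a (h + k).
Proof.
move=> Th Tk a_ t_ Ca aa pos_t t_0.
have [//|//|//|//|v_ vh Cv] := Th a_ t_.
have [//||//|//|w_ wk Cw] := Tk (fun n => a_ n + t_ n *: v_ n) t_.
  by rewrite -[a]addr0 -(scale0r h); apply: cvgD => //; exact: cvgZ.
exists (fun n => v_ n + w_ n); first exact: cvgD.
by move=> n; rewrite scalerDr addrA.
Qed.

Lemma clarke_normal0 C a : clarke_normal C a (0 : V -> R^o).
Proof.
have zE x : (0 : V -> R^o) x = 0 by [].
split=> [|h _]; last by rewrite zE.
apply: (@bounded_dual _ _ _ 0) => [t x y|x]; first by rewrite !zE scaler0 addr0.
by rewrite zE normr0 mul0r.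
Qed.

Lemma clarke_normalZ C a f t : 0 <= t ->
  clarke_normal C a f -> clarke_normal C a (t *: f).
Proof.
move=> t0 [df f0]; split=> [|h Th]; first exact: dual_scale.
by apply: mulr_ge0_le0 => //; exact: f0.
Qed.

End TangentCone.

(** * Minima of convex functions on arbitrary sets *)

Section FermatRule.
Set Implicit Arguments.
Unset Strict Implicit.
Context {R : realType} {V : normedModType R} (C : set V) (g : V -> R) (L : R).
Context (z : V) (Cz : C z).
Context (cvx : forall u v t, 0 <= t <= 1 ->
  g (t *: u + (1 - t) *: v) <= t * g u + (1 - t) * g v).
Context (lip : forall u v, g u - g v <= L * `|u - v|).
Context (gmin : forall u, C u -> g z <= g u).

(** Points of [C] close to [z + t k] exist for small [t] by tangency, and there
    [g] is at least [g z]; convexity transports the resulting inequality from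
    [z + t k] to [z + k], at the price of an error [L |v - k|] that vanishes. *)
Lemma minimum_along_tangent k : clarke_tangent C z k -> g z <= g (z + k).
Proof.
move=> Tk.
have [//||||v_ vk Cv] := Tk (fun=> z) harmonic; first exact: cvg_cst.
- by move=> n; rewrite /harmonic/= invr_gt0 ltr0n.
- exact: cvg_harmonic.
have lb n : g z <= g (z + k) + L * `|v_ n - k|.
  pose t : R := harmonic n.
  have t0 : 0 < t by rewrite /t/harmonic/= invr_gt0 ltr0n.
  have t1 : t <= 1 by rewrite /t/harmonic/= invf_le1 ?ltr0n// ler1n.
  have le1 := gmin (Cv n).
  have le2 := lip (z + t *: v_ n) (t *: (z + k) + (1 - t) *: z).
  have le3 : g (t *: (z + k) + (1 - t) *: z) <= t * g (z + k) + (1 - t) * g z.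
    by apply: cvx; rewrite ltW.
  have combE : t *: (z + k) + (1 - t) *: z = z + t *: k.
    rewrite scalerDr scalerBl scale1r [_ + t *: k]addrC -addrA subrKC.
    exact: addrC.
  have distE : `|z + t *: v_ n - (z + t *: k)| = t * `|v_ n - k|.
    by rewrite opprD addrACA subrr add0r -scalerBr normrZ gtr0_norm.
  rewrite combE in le2 le3; rewrite distE in le2.
  rewrite -(ler_pM2l t0); lra.
have v0 : g (z + k) + L * `|v_ n - k| @[n --> \oo] --> g (z + k) + L * 0.
  apply: cvgD; first exact: cvg_cst.
  by apply: cvgMl_tmp; apply/norm_cvg0P/subr_cvg0.
rewrite -[leRHS]addr0 -(mulr0 L); apply: (cvgr_to_ge v0).
exact: nearW.
Qed.

(** Optimality condition: [0] belongs to the sum of the subdifferential of [g] at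
    [z], which contains [- psi], and of the normal cone of [C] at [z]. The
    functional [- psi] must stay below the difference quotients
    [s (g w - g z)] in the directions [s (w - z)] and be nonnegative on the
    tangent cone. Both demands are put in a single cone of constraints, and these
    are consistent above [0] exactly because [z] minimizes [g] along tangent
    directions. *)
Lemma fermat_clarke_normal : exists psi : V -> R^o,
  [/\ clarke_normal C z psi, forall h, `|psi h| <= L * `|h| &
      forall w, psi (z - w) <= g w - g z].
Proof.
pose K : set (V * R) := [set x | exists (s : R) k w,
  [/\ 0 < s, clarke_tangent C z k, x.1 = s *: (w - z) - k &
      s * (g w - g z) <= x.2]].
have KI w k : clarke_tangent C z k -> K (w - z - k, g w - g z).
  by move=> Tk; exists 1, k, w; split; rewrite ?scale1r ?mul1r.
have coneK : minorizing_cone K.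
  split.
  - by have := KI z 0 (@clarke_tangent0 _ _ C z); rewrite !subrr.
  - move=> h1 r1 h2 r2 [s1 [k1 [w1 [/= s10 Tk1 -> gw1]]]].
    move=> [s2 [k2 [w2 [/= s20 Tk2 -> gw2]]]].
    have s0 : 0 < s1 + s2 by exact: addr_gt0.
    have sn0 := lt0r_neq0 s0.
    (* the weights that make the point w of the sum a convex combination *)
    pose t := s1 / (s1 + s2).
    have t1 : 1 - t = s2 / (s1 + s2) by rewrite /t; field.
    have st : (s1 + s2) * t = s1 by rewrite /t; field.
    have st1 : (s1 + s2) * (1 - t) = s2 by rewrite t1; field.
    have t01 : 0 <= t <= 1.
      by rewrite -[t <= 1]subr_ge0 t1 /t !divr_ge0 ?ltW.
    exists (s1 + s2), (k1 + k2), (t *: w1 + (1 - t) *: w2); split=> //=.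
    + exact: clarke_tangentD.
    + rewrite !scalerBr scalerDr !scalerA st st1 scalerDl.
      by rewrite [LHS]addrACA -opprD [X in X - _ = _]addrACA -opprD.
    + apply: (le_trans _ (lerD gw1 gw2)).
      have /(ler_wpM2l (ltW s0)) := cvx w1 w2 t01.
      have -> : (s1 + s2) * (t * g w1 + (1 - t) * g w2) = s1 * g w1 + s2 * g w2.
        by rewrite mulrDr mulrA st mulrA st1.
      lra.
  - move=> t _ r t0 [s [k [w [/= s0 Tk -> gw]]]].
    exists (t * s), (t *: k), w; split=> /=.
    + exact: mulr_gt0.
    + exact: clarke_tangentZ.
    + by rewrite scalerBr scalerA.
    + by rewrite -mulrA ler_pM2l.
  - move=> r [s [k [w [/= s0 Tk /esym/eqP]]]]; rewrite subr_eq0 => /eqP wk.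
    apply: le_trans; apply: mulr_ge0; first exact: ltW.
    rewrite subr_ge0.
    have -> : w = z + s^-1 *: k.
      by rewrite -wk scalerA mulVf ?gt_eqF// scale1r addrC subrK.
    apply: minimum_along_tangent.
    by apply: clarke_tangentZ; rewrite ?invr_gt0.
have [h|phi linphi phiK] := linear_minorant coneK.
  by exists (g (z + h) - g z); have := KI (z + h) 0 (@clarke_tangent0 _ _ C z);
    rewrite subr0 addrC addKr.
have phi_le w : phi (w - z) <= g w - g z.
  by apply: phiK; rewrite -[w - z]subr0; apply: KI; exact: clarke_tangent0.
have [_ _ phiN] := linear_rules linphi.
have phiL h : phi h <= L * `|h|.
  have := le_trans (phi_le (z + h)) (lip (z + h) z).
  by rewrite [z + h]addrC addrK.
have phi_norm h : `|phi h| <= L * `|h|.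
  by rewrite ler_norml phiL andbT lerNl -phiN -(normrN h).
exists (fun h => phi (- h)); split=> [|h|w]; last 2 first.
- by rewrite -(normrN h).
- by rewrite opprB.
split=> [|h Th].
  apply: (@bounded_dual _ _ _ L) => [t u v|h]; last by rewrite -(normrN h).
  by rewrite opprD -scalerN linphi.
have := phiK (z - z - h) (g z - g z); rewrite !subrr sub0r; apply.
by have := KI z h Th; rewrite !subrr sub0r.
Qed.

End FermatRule.

(** * Ekeland's variational principle *)

Section Ekeland.
Set Implicit Arguments.
Unset Strict Implicit.
Context {R : realType} {V : completeNormedModType R}.

(** Call [u] below [v] when [f u + eta |u - v| <= f v], a transitive relation. A
    sequence whose next term nearly minimizes [f] among the points below the
    current one is Cauchy, since the convergent values [f (u n)] control the
    distances. Its limit [z] is below every term. A point strictly better than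
    [z] would be below every term too, but the terms are asymptotically at least
    as good as any such point. *)
Lemma ekeland (S : set V) (f : V -> R) (m eta : R) u0 :
  closed S -> continuous f -> (forall u, S u -> m <= f u) -> 0 < eta -> S u0 ->
  exists z,
    [/\ S z, f z <= f u0 & forall u, S u -> f z <= f u + eta * `|u - z|].
Proof.
move=> clS cf fm eta0 Su0.
pose below v := [set u | S u /\ f u + eta * `|u - v| <= f v].
have below_refl v : S v -> below v v.
  by move=> Sv; split=> //; rewrite subrr normr0 mulr0 addr0.
have below_trans u v w : below v u -> below w v -> below w u.
  move=> [Su uv] [Sv vw]; split=> //; apply: le_trans vw.
  have := ler_distD v u w; rewrite -(ler_pM2l eta0) mulrDr; lra.
have next (n : nat) v : exists u, S v -> below v u /\
    forall w, below v w -> f u <= f w + n.+1%:R^-1.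
  have [Sv|nSv] := pselect (S v); last by exists v.
  have e0 : 0 < n.+1%:R^-1 :> R by rewrite invr_gt0 ltr0n.
  have hinf : has_inf (f @` below v).
    split; first by exists (f v), v => //; exact: below_refl.
    by exists m => _ [u [Su _] <-]; exact: fm.
  have [_ [u vu <-] fu] := inf_adherent e0 hinf.
  exists u => _; split=> // w vw; apply: (le_trans (ltW fu)); rewrite lerD2r.
  by apply: ge_inf; [case: hinf | exists w].
pose step n v := projT1 (cid (next n v)).
pose u := fix u n := if n is n'.+1 then step n' (u n') else u0.
have stepP n v : S v -> below v (step n v) /\
    forall w, below v w -> f (step n v) <= f w + n.+1%:R^-1.
  exact: (projT2 (cid (next n v))).
have Su n : S (u n) by elim: n => // n /(stepP n)[[]].
have mono n p : below (u n) (u (n + p)%N).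
  elim: p => [|p IH]; first by rewrite addn0; exact: below_refl.
  have [stp _] := stepP (n + p)%N _ (Su (n + p)%N).
  by rewrite addnS; exact: (below_trans _ _ _ stp IH).
have fu_noninc : nonincreasing_seq (f \o u).
  apply/nonincreasing_seqP => n /=.
  have [_] := mono n 1%N; rewrite addn1; apply: le_trans.
  by rewrite lerDl mulr_ge0// ltW.
have fu_cvg : cvgn (f \o u).
  by apply: nonincreasing_is_cvgn => //; exists m => _ [n _ <-]; exact: fm.
have u_cauchy : cauchy (u @ \oo).
  apply: cauchy_exP => eps eps0.
  have eta_eps : 0 < eta * eps by exact: mulr_gt0.
  have [N _ uN] := cvgr_lt _ fu_cvg _ (ltr_pwDr eta_eps (lexx _)).
  exists (u N), N => // n /= /subnKC <-.
  have [_ uNn] := mono N (n - N)%N.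
  have := nonincreasing_cvgn_ge fu_noninc fu_cvg (N + (n - N))%N.
  have := uN N (leqnn N) => /= uN1 uN2.
  rewrite -ball_normE /ball_/= distrC -(ltr_pM2l eta0); lra.
have /cvg_ex[z uz] : cvgn u by exact: cauchy_cvg.
have fuz : f (u n) @[n --> \oo] --> f z by exact: (cvg_comp _ _ uz (cf z)).
have zbelow n : below (u n) z.
  split; first exact: (closed_cvg _ clS (nearW _ Su) z uz).
  have lhs : f (u p) + eta * `|u p - u n| @[p --> \oo] -->
      f z + eta * `|z - u n|.
    apply: cvgD => //; apply: cvgMl_tmp; apply: cvg_norm.
    by apply: cvgB => //; exact: cvg_cst.
  apply: (cvgr_to_le lhs); exists n => // p /= /subnKC <-.
  by have [] := mono n (p - n)%N.
exists z; split; first by have [] := zbelow 0%N.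
  have [_] := zbelow 0%N; apply: le_trans.
  by rewrite lerDl mulr_ge0// ltW.
move=> w Sw; rewrite leNgt; apply/negP => fw_lt.
have wbelow n : below (u n) w.
  by apply: (below_trans _ _ _ _ (zbelow n)); split=> //; exact: ltW.
have fz_le n : f z <= f w + n.+1%:R^-1.
  have [_ /(_ w (wbelow n)) fun1] := stepP n _ (Su n).
  have [_ fzn] := zbelow n.+1; apply: le_trans fun1; apply: le_trans fzn.
  by rewrite lerDl mulr_ge0// ltW.
have rhs : f w + n.+1%:R^-1 @[n --> \oo] --> f w + 0.
  by apply: cvgD; [exact: cvg_cst | exact: cvg_harmonic].
have fzw : f z <= f w + 0 by apply: (cvgr_to_ge rhs); exact: nearW.
have := mulr_ge0 (ltW eta0) (normr_ge0 (w - z)); lra.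
Qed.

End Ekeland.

(** * Normals that point towards a given point *)

Section NormalTowardsPoint.
Set Implicit Arguments.
Unset Strict Implicit.
Context {R : realType} {V : completeNormedModType R}.

(** Evaluating the Fermat rule for [g u = |x - u| + |u - z| / 3] at [u = x] gives
    [psi (x - z) >= 2/3 |x - z|] for a normal [psi] of norm at most [4/3];
    rescaling by [3/4] turns the two constants into [1/2] and [1]. *)
Lemma exists_normal_towards (S : set V) (a x : V) : closed S -> S a ->
  exists z psi, [/\ S z, `|x - z| <= `|x - a|,
    (clarke_normal S z `&` dual_ball V) psi & `|x - z| <= 2 * psi (x - z)].
Proof.
move=> clS Sa.
have cont_dist : continuous (fun u => `|x - u| : R).
  move=> u; apply: cvg_norm; apply: cvgB; [exact: cvg_cst | exact: cvg_id].
have eta0 : 0 < 3^-1 :> R by rewrite invr_gt0.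
have [z [Sz za zmin]] :=
  ekeland clS cont_dist (fun u _ => normr_ge0 (x - u)) eta0 Sa.
pose g u : R := `|x - u| + 3^-1 * `|u - z|.
have gz : g z = `|x - z| by rewrite /g subrr normr0 mulr0 addr0.
have cvx u v t : 0 <= t <= 1 ->
    g (t *: u + (1 - t) *: v) <= t * g u + (1 - t) * g v.
  move=> /andP[t0 t1].
  have dist_cvx w :
      `|t *: u + (1 - t) *: v - w| <= t * `|u - w| + (1 - t) * `|v - w|.
    have -> : t *: u + (1 - t) *: v - w = t *: (u - w) + (1 - t) *: (v - w).
      by rewrite !scalerBr addrACA -opprD -scalerDl [t + _]addrC subrK scale1r.
    apply: (le_trans (ler_normD _ _)).
    by rewrite !normrZ ger0_norm// ger0_norm// subr_ge0.
  have := dist_cvx x; have := dist_cvx z; rewrite /g !(distrC x); lra.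
have lip u v : g u - g v <= 4 / 3 * `|u - v|.
  have := ler_distD v x u; have := ler_distD v u z.
  by rewrite /g [`|v - u|]distrC; lra.
have gmin u : S u -> g z <= g u by move=> Su; rewrite gz; exact: zmin.
have [psi [Npsi psiL psig]] := fermat_clarke_normal Sz cvx lip gmin.
have [dpsi _] := Npsi; have [_ _ psiN] := linear_rules dpsi.1.
pose xi : V -> R^o := 3 / 4 *: psi.
have xiE h : xi h = 3 / 4 * psi h by [].
exists z, xi; split=> //; last first.
  by have := psig x; rewrite gz /g subrr normr0 -opprB psiN xiE; lra.
split; first by apply: clarke_normalZ.
apply/dual_ballP; split; first by have [] := dual_scale (3 / 4) dpsi.
by move=> h; rewrite xiE normrM ger0_norm//; have := psiL h; lra.
Qed.

End NormalTowardsPoint.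

(** * Graphs of multifunctions and of their inverses *)

Section InverseGraph.
Set Implicit Arguments.
Unset Strict Implicit.
Context {R : realType} {X Y : normedModType R}.
Implicit Type F : X -> set Y.

Lemma clarke_tangent_gph_inv F x y h :
  clarke_tangent (gph (inv_mf F)) (y, x) h ->
  clarke_tangent (gph F) (x, y) (swap h).
Proof.
move=> Th a_ t_ Fa aa t0 tt.
have [|||//|v_ vh Fv] := Th (swap \o a_) t_; [exact: Fa | | exact: t0 |].
  exact: (cvg_comp _ _ aa (@swap_continuous X Y (x, y))).
exists (swap \o v_); last exact: Fv.
exact: (cvg_comp _ _ vh (@swap_continuous Y X h)).
Qed.

Lemma clarke_normal_gph_inv F x y f g :
  clarke_normal (gph F) (x, y) (dual_pair f g) ->
  clarke_normal (gph (inv_mf F)) (y, x) (dual_pair g f).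
Proof.
have swapE : dual_pair g f = dual_pair f g \o swap.
  by apply/funext => p; rewrite /dual_pair /= addrC.
rewrite swapE => -[[linfg cfg] Nfg].
split=> [|h /clarke_tangent_gph_inv/Nfg//].
split=> [t p q|p]; first by rewrite /= -linfg.
by apply: continuous_comp; [exact: swap_continuous | exact: cfg].
Qed.

Lemma closed_solution_set F (A : set X) (b : Y) : closed (gph F) -> closed A ->
  closed (solution_set F A b).
Proof.
move=> clF clA.
rewrite (_ : solution_set F A b = A `&` (fun x => (x, b)) @^-1` gph F)//.
apply: closedI => //; apply: preimage_closed => // x _.
by apply: cvg_pair => /=; [exact: cvg_id | exact: cvg_cst].
Qed.

End InverseGraph.

(** * Distances to sets *)

Section DistanceBounds.
Set Implicit Arguments.
Unset Strict Implicit.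
Context {R : realType}.

Lemma edistE (X : normedModType R) (x y : X) : edist (x, y) = `|x - y|%:E.
Proof.
rewrite /edist -ball_normE /ball_/=; apply/le_anti/andP; split.
  apply/lee_addgt0Pr => e e0; apply: ereal_inf_lbound.
  exists (`|x - y| + e) => //; split=> /=; last by rewrite ltrDl.
  by rewrite ltr_wpDl.
by apply: le_ereal_inf_tmp => _ [r [_ xy] <-]; rewrite lee_fin ltW.
Qed.

Lemma edist_inf_le (X : normedModType R) (S : set X) x z :
  S z -> (edist_inf S x <= `|x - z|%:E)%E.
Proof. by move=> Sz; rewrite -edistE; apply: ereal_inf_lbound; exists z. Qed.

Lemma le_edist_inf (X : normedModType R) (S : set X) x (D : R) :
  (forall z, S z -> D <= `|x - z|) -> (D%:E <= edist_inf S x)%E.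
Proof.
move=> DS; apply: le_ereal_inf_tmp => _ [z Sz <-].
by rewrite edistE lee_fin; exact: DS.
Qed.

Lemma le_add_edist_inf (X Y : normedModType R) (B : set Y) (A : set X)
    (b : Y) (x : X) (D : R) :
  (forall y u, B y -> A u -> D <= `|b - y| + `|x - u|) ->
  (D%:E <= edist_inf B b + edist_inf A x)%E.
Proof.
move=> DBA; case dB : (edist_inf B b) => [i| |].
- rewrite addeC -leeBlDr// -EFinB; apply: le_edist_inf => u Au.
  rewrite lerBlDl -lerBlDr -lee_fin -dB; apply: le_edist_inf => y By.
  by rewrite lerBlDr; exact: DBA.
- by rewrite addye ?leey.
- by have := edist_inf_ge0 B b; rewrite dB.
Qed.

(** Reduces subregularity to an estimate between points. An empty [F x] is
    covered: the estimate is then void and the distance to [F x] infinite. *)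
Lemma metrically_subregularI (X Y : normedModType R) (F : X -> set Y)
    (A : set X) (b : Y) (a : X) (K r : R) :
  solution_set F A b a -> 0 < K -> 0 < r ->
  (forall x u y, `|x - a| < r -> A u -> F x y ->
     exists2 z, solution_set F A b z & `|x - z| <= K * (`|b - y| + `|x - u|)) ->
  metrically_subregular F A b a.
Proof.
move=> Sa K0 r0 est; exists K => //.
near=> x.
have xa : `|x - a| < r by rewrite distrC; near: x; exact: cvgr_dist_lt.
have : edist_inf (solution_set F A b) x \is a fin_num.
  rewrite ge0_fin_numE ?edist_inf_ge0//.
  exact: le_lt_trans (edist_inf_le _ Sa) (ltry _).
case DS : (edist_inf (solution_set F A b) x) => [D| |]// _.
rewrite -lee_pdivrMl// -EFinM; apply: le_add_edist_inf => y u Fxy Au.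
have [z Sz xz] := est x u y xa Au Fxy.
rewrite ler_pdivrMl//; apply: le_trans xz.
by rewrite -lee_fin -DS; exact: edist_inf_le.
Unshelve. all: by end_near. Qed.

End DistanceBounds.

(** * Normals to subsmooth sets and multifunctions *)

Section SubsmoothEstimates.
Set Implicit Arguments.
Unset Strict Implicit.
Context {R : realType} {X Y : normedModType R}.

(** Comparing with the zero normal at [u] turns the two-point monotonicity of
    normals into a one-sided bound. *)
Lemma subsmooth_normal_le (A : set X) a (eps : R) : subsmooth A a -> 0 < eps ->
  exists2 delta : R, 0 < delta & forall z u xs,
    (ball a delta `&` A) z -> (ball a delta `&` A) u ->
    (clarke_normal A z `&` dual_ball X) xs -> xs (u - z) <= eps * `|u - z|.
Proof.
move=> smA eps0; have [delta delta0 sm] := smA eps eps0.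
exists delta => // z u xs zA uA xsN.
have zero0 : (clarke_normal A u `&` dual_ball X) (0 : X -> R^o).
  split; first exact: clarke_normal0.
  by apply/dual_ballP; split=> [t v w|v]; rewrite ?scaler0 ?addr0 ?normr0.
have [[dxs _] _] := xsN; have [_ _ xsNe] := linear_rules dxs.1.
have := sm z u xs 0 zA uA xsN zero0.
by rewrite subr0 -(opprB u z) xsNe normrN mulNr lerN2.
Qed.

(** The normal [(xs, - ys)] to the graph need not lie in the unit ball, where
    subsmoothness speaks; dividing it by [M] brings it there, and multiplying
    back replaces [eps] by [M eps]. The summand [|b - y|] bounds the
    contribution [ys (y - b)]. *)
Lemma L_subsmooth_coderivative_le (F : X -> set Y) a b (eps : R) :
  calL_subsmooth F a b -> 0 < eps ->
  exists2 delta : R, 0 < delta & forall (M : R) z ys xs x y, 1 <= M ->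
    F z b -> ball a delta z -> dual_ball Y ys ->
    clarke_coderivative F z b ys xs -> (forall h, `|xs h| <= M * `|h|) ->
    F x y -> `|x - a| + `|b - y| < delta ->
    xs (x - z) <= `|b - y| + M * eps * (`|b - y| + `|x - z|).
Proof.
move=> LF eps0; have [delta delta0 smF] := LF eps eps0.
exists delta => // M z ys xs x y M1 Fzb az ys1 [dxs Nys] xs_le Fxy xy_near.
have M0 : 0 < M by exact: lt_le_trans M1.
have MV0 : 0 < M^-1 by rewrite invr_gt0.
have [_ ys_le] := (dual_ballP _).1 ys1.
pose vs : X -> R^o := M^-1 *: xs.
pose us : Y -> R^o := M^-1 *: (- ys).
have us_val h : us h = M^-1 * - ys h by [].
have vs_val h : vs h = M^-1 * xs h by [].
have : us (y - b) + vs (x - z) <= eps * (`|y - b| + `|x - z|).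
  apply: smF; rewrite ?[`|y - b|]distrC.
  - by split.
  - have := clarke_normalZ (ltW MV0) (clarke_normal_gph_inv Nys).
    congr (clarke_normal _ _ _); apply/funext => h.
    by rewrite /dual_pair -scalerDr.
  - apply/dual_ballP; split.
      by have [] := dual_scale M^-1 (dual_scale (-1) ys1.1); rewrite scaleN1r.
    move=> h; rewrite us_val normrM normrN gtr0_norm// ler_pdivrMl//.
    by apply: (le_trans (ys_le h)); rewrite ler_peMl.
  - apply/dual_ballP; split; first by have [] := dual_scale M^-1 dxs.
    by move=> h; rewrite vs_val normrM gtr0_norm// ler_pdivrMl.
  - exact: Fxy.
  - by rewrite addrC.
rewrite us_val vs_val [`|y - b|]distrC -mulrDr ler_pdivrMl// mulrA => sm.
have := le_trans (ler_norm _) (ys_le (y - b)); rewrite [`|y - b|]distrC.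
lra.
Qed.

End SubsmoothEstimates.

(** * Metric subregularity *)

Theorem theorem4p3 (R : realType) (X Y : completeNormedModType R)
    (F : X -> set Y) (A : set X) (b : Y) (a : X)
    (hF : closed (gph F)) (hA : closed A)
    (ha : solution_set F A b a)
    (hFs : calL_subsmooth F a b)
    (hAs : subsmooth A a)
    (hN : exists tau delta : R, 0 < tau /\ 0 < delta /\
      forall z : X, (solution_set F A b `&` ball a delta) z ->
        clarke_normal (solution_set F A b) z `&` dual_ball X `<=`
        mink_scale tau
          (mink_add (clarke_coderivative_set F z b (dual_ball Y))
                    (clarke_normal A z `&` dual_ball X))) :
  metrically_subregular F A b a.
Proof.
have [tau [delta [tau0 [delta0 normS]]]] := hN.
(* M bounds the coderivative part x1 = psi / tau - x2, and eps is chosen so that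
   the total loss 2 tau (M + 1) eps is 1/2 *)
pose M : R := 1 + tau^-1.
pose eps : R := 4^-1 / (2 * tau + 1).
have tauV0 : 0 < tau^-1 by rewrite invr_gt0.
have M1 : 1 <= M by rewrite lerDl ltW.
have M0 : 0 < M by exact: lt_le_trans M1.
have eps0 : 0 < eps by rewrite divr_gt0//; lra.
have eps_sum : tau * (M * eps) + tau * eps = 4^-1.
  by rewrite /M /eps; field; apply/andP; split; apply: lt0r_neq0; lra.
have e10 : 0 < tau * (M * eps) by apply: mulr_gt0 => //; exact: mulr_gt0.
have e20 : 0 < tau * eps by exact: mulr_gt0.
have [dA dA0 smA] := subsmooth_normal_le hAs eps0.
have [dF dF0 smF] := L_subsmooth_coderivative_le hFs eps0.
pose r := Num.min delta (Num.min dA dF) / 2.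
have r0 : 0 < r by rewrite divr_gt0// !lt_min delta0 dA0 dF0.
have [r_delta r_dA r_dF] : [/\ 2 * r <= delta, 2 * r <= dA & 2 * r <= dF].
  by rewrite /r mulrC divfK//; rewrite !ge_min !lexx !orbT.
apply: (metrically_subregularI (K := 4 * tau + 1) ha _ r0); first by lra.
move=> x u y xa Au Fxy.
have tau_pq (p q : R) : 0 <= p -> 0 <= q -> 0 <= tau * (p + q).
  by move=> p0 q0; rewrite mulr_ge0 ?addr_ge0// ltW.
have := tau_pq _ _ (normr_ge0 (b - y)) (normr_ge0 (x - u)).
have := normr_ge0 (b - y); have := normr_ge0 (x - u).
(* the distance from x to a is below r, so a itself serves if u or y is far *)
have [far_u|near_u] := leP r `|x - u|; first by exists a => //; lra.
have [far_y|near_y] := leP r `|b - y|; first by exists a => //; lra.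
move=> q0 p0 taupq0.
have [z [psi [Sz xz [Npsi psi1] xz_psi]]] :=
  exists_normal_towards x (closed_solution_set hF hA) ha.
have az : `|a - z| < 2 * r.
  by have := ler_distD x a z; rewrite [`|a - x|]distrC; lra.
have au : `|a - u| < 2 * r.
  by have := ler_distD x a u; rewrite [`|a - x|]distrC; lra.
have [Az Fzb] := Sz.
have in_ball v d : 2 * r <= d -> `|a - v| < 2 * r -> ball a d v.
  by move=> rd av; rewrite -ball_normE /ball_/=; exact: lt_le_trans rd.
have [_ [x1 [ys ys1 Dx1] [x2 [Nx2 x21] <-]] psiE] :=
  normS z (conj Sz (in_ball _ _ r_delta az)) psi (conj Npsi psi1).
have psi_val h : psi h = tau * (x1 h + x2 h) by rewrite -psiE.
have [_ psi_le] := (dual_ballP _).1 psi1.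
have [_ x2_le] := (dual_ballP _).1 x21.
have x1_le h : `|x1 h| <= M * `|h|.
  have -> : x1 h = tau^-1 * psi h - x2 h.
    by rewrite psi_val mulKf ?gt_eqF// addrK.
  rewrite (le_trans (ler_normB _ _))// normrM gtr0_norm//.
  rewrite /M mulrDl mul1r addrC lerD//.
  by rewrite ler_pM2l.
have x1_bound : x1 (x - z) <= `|b - y| + M * eps * (`|b - y| + `|x - z|).
  apply: (smF M z ys x1 x y) => //; first exact: in_ball az.
  lra.
have x2_bound : x2 (x - z) <= `|x - u| + eps * (`|x - u| + `|x - z|).
  have xuz : x - z = (x - u) + (u - z) by rewrite addrA subrK.
  have [x2D _ _] := linear_rules Nx2.1.1.
  rewrite {1}xuz x2D lerD//; first exact: le_trans (ler_norm _) (x2_le _).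
  apply: (le_trans (smA z u x2 _ _ (conj Nx2 x21))).
  - by split=> //; exact: in_ball az.
  - by split=> //; exact: in_ball au.
  - by rewrite ler_pM2l// [`|x - u|]distrC ler_distD.
exists z => //.
have b1 := ler_wpM2l (ltW tau0) x1_bound.
have b2 := ler_wpM2l (ltW tau0) x2_bound.
have quarter (t : R) : tau * (M * eps) * t + tau * eps * t = 4^-1 * t.
  by rewrite -mulrDl eps_sum.
have := quarter `|x - z|; have := quarter `|b - y|; have := quarter `|x - u|.
have := mulr_ge0 (ltW e10) q0; have := mulr_ge0 (ltW e20) p0.
move: xz_psi; rewrite psi_val; lra.
Qed.
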